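(* There is a linear-size conservative reduction from $\mathrm{FO}_{=}$ formulas into $\mathrm{FO}3$ formulas without equality; that is, a computable map $f$ from $\mathrm{FO}_{=}$ formulas to $\mathrm{FO}3$ formulas without equality such that $\|f(\varphi)\|$ is bounded by a linear function of $\|\varphi\|$, $\varphi$ is satisfiable iff $f(\varphi)$ is satisfiable, and $\varphi$ is finitely satisfiable iff $f(\varphi)$ is finitely satisfiable.
   Context: Fix a countably infinite set $\Sigma$ of binary predicate symbols and a countably infinite set $\mathbf{V}$ of variables. A structure $\mathfrak{A}$ over a set of symbols consists of a non-empty set $|\mathfrak{A}|$ and a binary relation on it for each symbol; it is finite if $|\mathfrak{A}|$ is finite. $\mathrm{FO}_{=}$ formulas: $\varphi::= a(x,y)\mid x=y\mid \lnot\varphi\mid \varphi\land\psi\mid \exists x,\varphi$ ($a\in\Sigma$, $x,y\in\mathbf{V}$), with the usual semantics. A formula is satisfiable (resp. finitely satisfiable) if some assignment in some structure (resp. finite structure) satisfies it. Size: $\|a(x,y)\|=\|x=y\|=3$, $\|\lnot\varphi\|=1+\|\varphi\|$, $\|\varphi\land\psi\|=1+\|\varphi\|+\|\psi\|$, $\|\exists x,\varphi\|=2+\|\varphi\|$. $\mathrm{V}(\varphi)$ is the set of variables occurring (free or bound) in $\varphi$; $\mathrm{FO}3_{=}$ is the set of formulas with $\#\mathrm{V}(\varphi)\le 3$, and $\mathrm{FO}3$ formulas without equality are those among them with no atom of the form $x=y$. *)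

(* Defs.v *)
From Stdlib Require Import Arith List FinFun.
Import ListNotations.

Definition symbol := nat.
Definition var := nat.

(** ** First-order formulas with equality over binary predicate symbols *)

Inductive formula : Type :=
| Atom : symbol -> var -> var -> formula
| Eq : var -> var -> formula
| Not : formula -> formula
| And : formula -> formula -> formula
| Ex : var -> formula -> formula.

Fixpoint fsize (phi : formula) : nat :=
  match phi with
  | Atom _ _ _ => 3
  | Eq _ _ => 3
  | Not p => 1 + fsize p
  | And p q => 1 + fsize p + fsize q
  | Ex _ p => 2 + fsize p
  end.

(** All variable occurrences, including the quantified ones, with repetitions. *)
Fixpoint vars (phi : formula) : list var :=
  match phi with
  | Atom _ x y => [x; y]
  | Eq x y => [x; y]
  | Not p => vars p
  | And p q => vars p ++ vars q
  | Ex x p => x :: vars p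
  end.

Definition num_vars (phi : formula) : nat :=
  length (nodup Nat.eq_dec (vars phi)).

Definition FO3eq (phi : formula) : Prop := num_vars phi <= 3.

Fixpoint equality_free (phi : formula) : Prop :=
  match phi with
  | Atom _ _ _ => True
  | Eq _ _ => False
  | Not p => equality_free p
  | And p q => equality_free p /\ equality_free q
  | Ex _ p => equality_free p
  end.

Definition FO3 (phi : formula) : Prop := FO3eq phi /\ equality_free phi.

(** ** Semantics *)

Record structure : Type := Structure {
  carrier :> Type;
  carrier_inhabited : inhabited carrier;
  interp : symbol -> carrier -> carrier -> Prop
}.

Definition finite_structure (A : structure) : Prop := Finite A.

Definition update {T : Type} (I : var -> T) (x : var) (d : T) : var -> T :=
  fun y => if Nat.eqb y x then d else I y.

Fixpoint satisfies (A : structure) (I : var -> A) (phi : formula) : Prop :=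
  match phi with
  | Atom a x y => interp A a (I x) (I y)
  | Eq x y => I x = I y
  | Not p => ~ satisfies A I p
  | And p q => satisfies A I p /\ satisfies A I q
  | Ex x p => exists d : A, satisfies A (update I x d) p
  end.

Definition satisfiable (phi : formula) : Prop :=
  exists (A : structure) (I : var -> A), satisfies A I phi.

Definition finitely_satisfiable (phi : formula) : Prop :=
  exists (A : structure) (I : var -> A),
    finite_structure A /\ satisfies A I phi.

(** ** Computable maps on formulas

    The model of computation is the weak call-by-value lambda-calculus (Plotkin;
    Forster and Smolka), with inductive data represented by Scott encodings.  Its
    computable functions are exactly the Turing-computable ones. *)

Inductive term : Type :=
| TVar : nat -> term                    (* de Bruijn index *)
| TApp : term -> term -> term
| TLam : term -> term.

(** Only closed terms are ever substituted, so [u] need not be shifted under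
    binders. *)
Fixpoint subst (s : term) (k : nat) (u : term) : term :=
  match s with
  | TVar n => if Nat.eqb n k then u else TVar n
  | TApp s1 s2 => TApp (subst s1 k u) (subst s2 k u)
  | TLam s1 => TLam (subst s1 (S k) u)
  end.

Fixpoint closed_below (k : nat) (s : term) : Prop :=
  match s with
  | TVar n => n < k
  | TApp s1 s2 => closed_below k s1 /\ closed_below k s2
  | TLam s1 => closed_below (S k) s1
  end.

Definition closed (s : term) : Prop := closed_below 0 s.

Inductive eval : term -> term -> Prop :=
| eval_lam (s : term) : eval (TLam s) (TLam s)
| eval_app (s t s' v w : term) :
    eval s (TLam s') -> eval t v -> eval (subst s' 0 v) w -> eval (TApp s t) w.

Fixpoint enc_nat (n : nat) : term :=
  match n with
  | 0 => TLam (TLam (TVar 1))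
  | S m => TLam (TLam (TApp (TVar 0) (enc_nat m)))
  end.

(** The [i]-th of the five constructors, applied to the encoded arguments [args],
    becomes [fun c_0 ... c_4 => c_i args]; [c_i] has de Bruijn index [4 - i]. *)
Definition enc_constructor (i : nat) (args : list term) : term :=
  TLam (TLam (TLam (TLam (TLam (fold_left TApp args (TVar (4 - i))))))).

Fixpoint enc_formula (phi : formula) : term :=
  match phi with
  | Atom a x y => enc_constructor 0 [enc_nat a; enc_nat x; enc_nat y]
  | Eq x y => enc_constructor 1 [enc_nat x; enc_nat y]
  | Not p => enc_constructor 2 [enc_formula p]
  | And p q => enc_constructor 3 [enc_formula p; enc_formula q]
  | Ex x p => enc_constructor 4 [enc_nat x; enc_formula p]
  end.

Definition computable (f : formula -> formula) : Prop :=
  exists t : term,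
    closed t /\
    forall phi : formula, eval (TApp t (enc_formula phi)) (enc_formula (f phi)).

(** ** Reductions *)

Definition linear_size (f : formula -> formula) : Prop :=
  exists c d : nat, forall phi : formula, fsize (f phi) <= c * fsize phi + d.

Definition conservative (f : formula -> formula) : Prop :=
  forall phi : formula,
    (satisfiable phi <-> satisfiable (f phi)) /\
    (finitely_satisfiable phi <-> finitely_satisfiable (f phi)).

(* Main.v *)
From Stdlib Require Import Arith List Lia FinFun Classical ClassicalEpsilon
  FunctionalExtensionality PropExtensionality ProofIrrelevance.
Require Import Defs.
Import ListNotations.

(** An element of a model of the reduced formula stands for a whole assignment.
    The variable bound at quantifier depth [d] is stored at slot [d]; the symbol
    [level_sym d] relates an assignment to the elements that denote the content
    of its slot [d], and an element denotes the content of its own slot [0].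
    Elements of the original structure are thus rows of [level_sym 0], and
    equality of variables is equality of rows, which is expressible without
    equality.  The symbol [agree_sym d] says that two assignments agree on the
    slots [1, ..., d - 1]: passing from [d] to [d + 1] adds one slot, so
    constantly many axioms per quantifier suffice to control all of these
    relations, and the total size stays linear.  Conversely the tuples over a
    structure form a model, which is finite if the structure is. *)

(** * Derived connectives *)

Definition All (x : var) (p : formula) : formula := Not (Ex x (Not p)).
Definition Imp (p q : formula) : formula := Not (And p (Not q)).
Definition Iff (p q : formula) : formula := And (Imp p q) (Imp q p).

Lemma satisfies_All (A : structure) (I : var -> A) x p :
  satisfies A I (All x p) <-> forall d : A, satisfies A (update I x d) p.
Proof.
  cbn; split.
  - intros H d. apply NNPP. intros N. apply H. now exists d.
  - intros H [d N]. exact (N (H d)).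
Qed.

Lemma satisfies_Imp (A : structure) (I : var -> A) p q :
  satisfies A I (Imp p q) <-> (satisfies A I p -> satisfies A I q).
Proof. cbn. destruct (classic (satisfies A I q)); tauto. Qed.

Lemma satisfies_Iff (A : structure) (I : var -> A) p q :
  satisfies A I (Iff p q) <-> (satisfies A I p <-> satisfies A I q).
Proof.
  change (satisfies A I (Imp p q) /\ satisfies A I (Imp q p) <->
          (satisfies A I p <-> satisfies A I q)).
  rewrite !satisfies_Imp. tauto.
Qed.

(** * The reduction: symbols, axioms and translation *)

Definition rel_sym (a : symbol) : symbol := 4 * a.
Definition free_sym (y : var) : symbol := S (4 * y).
Definition level_sym (k : nat) : symbol := S (S (4 * k)).
Definition agree_sym (d : nat) : symbol := S (S (S (4 * d))).
(** Slot [0] is reserved for what an element itself denotes. Quantifier depths start at [1], so no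
    bound variable is ever stored there. *)
Definition value_sym : symbol := level_sym 0.

(** The outer [Ex] comes before the quantification over assignments: the value of a free variable is
    the same in all of them. *)
Definition free_axiom (y : var) : formula :=
  Ex 1 (All 0 (All 2 (Iff (Atom (free_sym y) 0 2) (Atom value_sym 1 2)))).

Definition level_total (d : nat) : formula :=
  All 0 (Ex 1 (All 2 (Iff (Atom (level_sym d) 0 2) (Atom value_sym 1 2)))).

Definition level_agree (d : nat) : formula :=
  All 0 (All 1 (Imp (Atom (agree_sym (S d)) 0 1)
    (And (Atom (agree_sym d) 0 1)
         (All 2 (Iff (Atom (level_sym d) 0 2) (Atom (level_sym d) 1 2)))))).

(** This makes room for a quantifier: any value can be put into slot [d] without disturbing the
    slots below. Variable [0] is rebound once the old assignment has been used, which keeps to three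
    variables. *)
Definition level_update (d : nat) : formula :=
  All 0 (All 1 (Ex 2 (And (Atom (agree_sym d) 0 2)
    (All 0 (Iff (Atom (level_sym d) 2 0) (Atom value_sym 1 0)))))).

Fixpoint axioms (phi : formula) (d : nat) : formula :=
  match phi with
  | Atom _ x y => And (free_axiom x) (free_axiom y)
  | Eq x y => And (free_axiom x) (free_axiom y)
  | Not p => axioms p d
  | And p q => And (axioms p d) (axioms q d)
  | Ex _ p => And (And (level_total d) (And (level_agree d) (level_update d)))
                  (axioms p (S d))
  end.

(* The current assignment is always held by the variable [0], so a quantifier
   moves to the variable [1] and back. *)
Fixpoint translate (phi : formula) (env : var -> symbol) (d : nat) : formula :=
  match phi with
  | Atom a x y => Ex 1 (And (Atom (env x) 0 1)
                    (Ex 2 (And (Atom (env y) 0 2) (Atom (rel_sym a) 1 2))))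
  | Eq x y => All 2 (Iff (Atom (env x) 0 2) (Atom (env y) 0 2))
  | Not p => Not (translate p env d)
  | And p q => And (translate p env d) (translate q env d)
  | Ex x p => Ex 1 (And (Atom (agree_sym d) 0 1)
                (Ex 0 (And (Atom (agree_sym d) 1 0)
                  (translate p (update env x (level_sym d)) (S d)))))
  end.

Definition reduction (phi : formula) : formula :=
  And (axioms phi 1) (Ex 0 (translate phi free_sym 1)).

(** * Syntactic bounds *)

(** An atom has size 3 whatever the index of its symbol, so the depth [d] does not enter the bound;
    each atom and each quantifier adds a constant. *)
Lemma axioms_size phi d : fsize (axioms phi d) <= 100 * fsize phi.
Proof.
  revert d; induction phi as [| |p IH|p IHp q IHq|x p IH];
    intros e; cbn -[Nat.mul].
  - lia.
  - lia.
  - specialize (IH e). lia.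
  - specialize (IHp e). specialize (IHq e). lia.
  - specialize (IH (S e)). lia.
Qed.

Lemma translate_size phi env d : fsize (translate phi env d) <= 20 * fsize phi.
Proof.
  revert env d; induction phi as [| |p IH|p IHp q IHq|x p IH];
    intros env e; cbn -[Nat.mul].
  - lia.
  - lia.
  - specialize (IH env e). lia.
  - specialize (IHp env e). specialize (IHq env e). lia.
  - specialize (IH (update env x (level_sym e)) (S e)). lia.
Qed.

Lemma reduction_linear_size : linear_size reduction.
Proof.
  (* [120] is the sum of the factors [100] and [20]; [3] pays for the outer [And] and [Ex]. *)
  exists 120, 3. intros phi. unfold reduction. cbn [fsize].
  pose proof (axioms_size phi 1). pose proof (translate_size phi free_sym 1). lia.
Qed.

Lemma FO3_of_vars phi :
  (forall x, In x (vars phi) -> x < 3) -> equality_free phi -> FO3 phi.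
Proof.
  intros H E. split; [|exact E].
  change (length (nodup Nat.eq_dec (vars phi)) <= length (seq 0 3)).
  apply NoDup_incl_length; [apply NoDup_nodup|].
  intros x Hx. apply nodup_In in Hx. apply in_seq. specialize (H x Hx). lia.
Qed.

Lemma axioms_vars phi d x : In x (vars (axioms phi d)) -> x < 3.
Proof.
  revert d; induction phi; intros e; cbn -[In]; rewrite ?in_app_iff; cbn [In];
    try (intuition lia); try apply IHphi.
  - intros [H|H]; eauto.
  - specialize (IHphi (S e)); intuition lia.
Qed.

Lemma translate_vars phi env d x : In x (vars (translate phi env d)) -> x < 3.
Proof.
  revert env d; induction phi; intros env e; cbn -[In]; rewrite ?in_app_iff;
    cbn [In]; try (intuition lia); try apply IHphi.
  - intros [H|H]; eauto.
  - specialize (IHphi (update env v (level_sym e)) (S e)); intuition lia.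
Qed.

Lemma axioms_equality_free phi d : equality_free (axioms phi d).
Proof. revert d; induction phi; cbn; intuition auto. Qed.

Lemma translate_equality_free phi env d : equality_free (translate phi env d).
Proof. revert env d; induction phi; cbn; intuition auto. Qed.

Lemma reduction_FO3 phi : FO3 (reduction phi).
Proof.
  apply FO3_of_vars.
  - unfold reduction. cbn -[In]. intros x [H|[H|H]]%in_app_iff.
    + exact (axioms_vars _ _ _ H).
    + lia.
    + exact (translate_vars _ _ _ _ H).
  - split; [apply axioms_equality_free | apply translate_equality_free].
Qed.

(** * Semantics of the axioms *)

Section AxiomSemantics.

Variable M : structure.

(** Here and in the next three lemmas, functional and propositional extensionality turn pointwise
    equivalence of rows into equality, so that rows can be rewritten. *)
Lemma satisfies_free_axiom (I : var -> M) y :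
  satisfies M I (free_axiom y) <->
  exists s, forall u, interp M (free_sym y) u = interp M value_sym s.
Proof.
  unfold free_axiom. cbn [satisfies]. split; intros [s H]; exists s.
  - intros u. rewrite satisfies_All in H. specialize (H u).
    rewrite satisfies_All in H. extensionality t. apply propositional_extensionality.
    specialize (H t). rewrite satisfies_Iff in H. exact H.
  - rewrite satisfies_All. intros u. rewrite satisfies_All. intros t.
    rewrite satisfies_Iff. cbn -[value_sym free_sym]. now rewrite (H u).
Qed.

Lemma satisfies_level_total (I : var -> M) d :
  satisfies M I (level_total d) <->
  forall u, exists s, interp M (level_sym d) u = interp M value_sym s.
Proof.
  unfold level_total. rewrite satisfies_All. apply Morphisms_Prop.all_iff_morphism.
  intros u. cbn [satisfies]. apply Morphisms_Prop.ex_iff_morphism. intros s.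
  rewrite satisfies_All. split.
  - intros H. extensionality t. apply propositional_extensionality.
    specialize (H t). rewrite satisfies_Iff in H. exact H.
  - intros H t. rewrite satisfies_Iff. cbn -[value_sym level_sym]. now rewrite H.
Qed.

Lemma satisfies_level_agree (I : var -> M) d :
  satisfies M I (level_agree d) <->
  forall u v, interp M (agree_sym (S d)) u v ->
    interp M (agree_sym d) u v /\
    interp M (level_sym d) u = interp M (level_sym d) v.
Proof.
  unfold level_agree. rewrite satisfies_All. apply Morphisms_Prop.all_iff_morphism.
  intros u. rewrite satisfies_All. apply Morphisms_Prop.all_iff_morphism.
  intros v. rewrite satisfies_Imp.
  apply Morphisms_Prop.iff_iff_iff_impl_morphism; [reflexivity|].
  cbn [satisfies]. rewrite satisfies_All.
  apply Morphisms_Prop.and_iff_morphism; [reflexivity|]. split.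
  - intros H. extensionality t. apply propositional_extensionality.
    specialize (H t). rewrite satisfies_Iff in H. exact H.
  - intros H t. rewrite satisfies_Iff. cbn -[level_sym]. now rewrite H.
Qed.

Lemma satisfies_level_update (I : var -> M) d :
  satisfies M I (level_update d) <->
  forall u s, exists v, interp M (agree_sym d) u v /\
    interp M (level_sym d) v = interp M value_sym s.
Proof.
  unfold level_update. rewrite satisfies_All. apply Morphisms_Prop.all_iff_morphism.
  intros u. rewrite satisfies_All. apply Morphisms_Prop.all_iff_morphism.
  intros s. cbn [satisfies]. apply Morphisms_Prop.ex_iff_morphism. intros v.
  rewrite satisfies_All.
  apply Morphisms_Prop.and_iff_morphism; [reflexivity|]. split.
  - intros H. extensionality t. apply propositional_extensionality.
    specialize (H t). rewrite satisfies_Iff in H. exact H.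
  - intros H t. rewrite satisfies_Iff. cbn -[value_sym level_sym]. now rewrite H.
Qed.

End AxiomSemantics.

(** * Correctness of the translation *)

(** Only variables of atoms receive a [free_axiom], so the invariants of the translation can be
    claimed only for these: a variable that is merely quantified may have no value under
    [free_sym]. *)
Fixpoint atom_vars (phi : formula) : list var :=
  match phi with
  | Atom _ x y => [x; y]
  | Eq x y => [x; y]
  | Not p => atom_vars p
  | And p q => atom_vars p ++ atom_vars q
  | Ex _ p => atom_vars p
  end.

Section Translation.

(* An element [a] of [A] is represented in [M] by a row of [value_sym]. *)
Variables (A M : structure) (row : A -> M -> Prop).
Hypothesis row_inj : forall a b, row a = row b -> a = b.
Hypothesis value_row : forall s, exists a, row a = interp M value_sym s.
Hypothesis row_value : forall a, exists s, row a = interp M value_sym s.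
Hypothesis rel_row : forall r a b, interp A r a b <->
  exists s t, row a s /\ row b t /\ interp M (rel_sym r) s t.

(** Both directions of the reduction use this. Two invariants are carried along: moving along
    [agree_sym d] does not change the row of a variable, and the row read at [I 0] represents the
    value under [J]. The assignment [K] for the axioms stays fixed while [I] changes, since the
    axioms are sentences. *)
Lemma translate_correct phi :
  forall d (K I : var -> M) (env : var -> symbol) (J : var -> A),
  satisfies M K (axioms phi d) ->
  (forall x u v, In x (atom_vars phi) -> interp M (agree_sym d) u v ->
     interp M (env x) u = interp M (env x) v) ->
  (forall x, In x (atom_vars phi) -> row (J x) = interp M (env x) (I 0)) ->
  satisfies A J phi <-> satisfies M I (translate phi env d).
Proof.
  induction phi as [a x y|x y|p IH|p IHp q IHq|x p IH];
    intros d K I env J Hax Hag Hrow; cbn [atom_vars translate] in *.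
  - cbn -[rel_sym]. rewrite rel_row, !Hrow by (cbn; tauto). split.
    + intros (s & t & H). now exists s; split; [|exists t].
    + intros (s & H1 & t & H2). now exists s, t.
  - rewrite satisfies_All. cbn [satisfies]. split.
    + intros H t. rewrite satisfies_Iff. cbn.
      rewrite <- !Hrow by (cbn; tauto). now rewrite H.
    + intros H. apply row_inj. rewrite !Hrow by (cbn; tauto).
      extensionality t. apply propositional_extensionality.
      specialize (H t). rewrite satisfies_Iff in H. exact H.
  - cbn. now rewrite (IH d K I env J).
  - destruct Hax as [Hp Hq]. cbn.
    rewrite (IHp d K I env J), (IHq d K I env J); try easy;
      intros; (apply Hag || apply Hrow); try apply in_or_app; auto.
  - destruct Hax as [[Ht [Ha Hu]] Hp].
    rewrite satisfies_level_total in Ht. rewrite satisfies_level_agree in Ha.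
    rewrite satisfies_level_update in Hu.
    (* After both moves the invariants hold again at depth [S d], whichever element [e] slot [d] of
       [w] represents; the two directions then differ only in how [e], [v] and [w] are found. *)
    assert (Key : forall e v w,
      interp M (agree_sym d) (I 0) v -> interp M (agree_sym d) v w ->
      row e = interp M (level_sym d) w ->
      satisfies A (update J x e) p <->
      satisfies M (update (update I 1 v) 0 w)
        (translate p (update env x (level_sym d)) (S d))).
    { intros e v w Hv Hw He. eapply IH; [exact Hp| |].
      (* [level_agree] splits agreement at [S d]: its slot [d] serves the new variable, agreement at
         [d] serves the old ones. *)
      - intros y u1 u2 Hy H12. apply Ha in H12 as [H1 H2].
        unfold update. destruct (Nat.eqb y x); [exact H2|now apply Hag].
      - intros y Hy. unfold update at 1 2. destruct (Nat.eqb y x); [exact He|].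
        rewrite Hrow, (Hag y _ v), (Hag y v w) by assumption. reflexivity. }
    cbn -[agree_sym]. split.
    + intros [e He]. destruct (row_value e) as [s Hs].
      (* No axiom makes [agree_sym d] reflexive, so the intermediate [v] also comes from
         [level_update]; it is [w] whose slot [d] must hold [e]. *)
      destruct (Hu (I 0) s) as (v & Hv & _). destruct (Hu v s) as (w & Hw & Hws).
      exists v. split; [exact Hv|]. exists w. split; [exact Hw|].
      apply (Key e); try assumption. congruence.
    (* [level_total] ensures that slot [d] of an arbitrary witness [w] denotes an element. *)
    + intros (v & Hv & w & Hw & H). destruct (Ht w) as [s Hs].
      destruct (value_row s) as [e He]. exists e.
      apply (Key e v w); try assumption. congruence.
Qed.

End Translation.

Lemma axioms_free phi d (M : structure) (K : var -> M) x :
  satisfies M K (axioms phi d) -> In x (atom_vars phi) ->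
  exists s, forall u, interp M (free_sym x) u = interp M value_sym s.
Proof.
  revert d; induction phi; cbn -[free_axiom]; intros d H Hx.
  - rewrite !satisfies_free_axiom in H. destruct Hx as [<-|[<-|[]]]; tauto.
  - rewrite !satisfies_free_axiom in H. destruct Hx as [<-|[<-|[]]]; tauto.
  - eauto.
  - apply in_app_iff in Hx. destruct H, Hx; eauto.
  - eapply IHphi; [apply H | exact Hx].
Qed.

(** * From models of the reduction to models of the formula *)

Section Rows.

Variable M : structure.

(** This is the quotient of [M] by equality of rows, with the rows themselves as elements. Equality
    of elements is then equality of rows, and the quotient is an image of [M], hence finite if [M]
    is. *)
Definition value_rows : Type :=
  {P : M -> Prop | exists s, P = interp M value_sym s}.

Definition value_row (s : M) : value_rows :=
  exist _ (interp M value_sym s) (ex_intro _ s eq_refl).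

Lemma value_rows_inhabited : inhabited value_rows.
Proof. destruct (carrier_inhabited M) as [s]. exact (inhabits (value_row s)). Qed.

Definition row_structure : structure :=
  {| carrier := value_rows;
     carrier_inhabited := value_rows_inhabited;
     interp := fun a P Q => exists s t, proj1_sig P s /\ proj1_sig Q t /\
                 interp M (rel_sym a) s t |}.

Lemma value_rows_eq (P Q : value_rows) : proj1_sig P = proj1_sig Q -> P = Q.
Proof.
  destruct P as [P HP], Q as [Q HQ]. cbn. intros <-.
  f_equal. apply proof_irrelevance.
Qed.

Lemma row_structure_finite : finite_structure M -> finite_structure row_structure.
Proof.
  intros [l Hl]. exists (map value_row l). intros [P [s ->]].
  apply in_map_iff. exists s. split; [now apply value_rows_eq|apply Hl].
Qed.

Lemma row_structure_satisfies (I : var -> M) phi :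
  satisfies M I (reduction phi) ->
  exists J : var -> row_structure, satisfies row_structure J phi.
Proof.
  intros [Hax [u Hu]].
  destruct (carrier_inhabited M) as [s0].
  (* The assignment must be total, so variables outside the atoms get the row of [s0] as a
     default. *)
  assert (Hfree : forall x, exists P : value_rows, In x (atom_vars phi) ->
            forall u, proj1_sig P = interp M (free_sym x) u).
  { intros x. destruct (classic (In x (atom_vars phi))) as [Hx|Hx].
    - destruct (axioms_free _ _ _ _ _ Hax Hx) as [s Hs].
      exists (value_row s). intros _ v. now rewrite Hs.
    - exists (value_row s0). tauto. }
  exists (fun x => proj1_sig (constructive_indefinite_description _ (Hfree x))).
  refine (proj2 (translate_correct row_structure M (@proj1_sig _ _)
    value_rows_eq _ _ _ phi 1 I _ free_sym _ Hax _ _) Hu).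
  - intros s. now exists (value_row s).
  - intros [P HP]. exact HP.
  - reflexivity.
  (* Rows of [free_sym] do not depend on the assignment, so the first invariant holds for any two
     elements. *)
  - intros x v w Hx _. destruct (Hfree x) as [P HP].
    now rewrite <- (HP Hx v), <- (HP Hx w).
  - intros x Hx. destruct constructive_indefinite_description as [P HP].
    exact (HP Hx u).
Qed.

End Rows.

(** * From models of the formula to models of the reduction *)

Section Tuples.

Variable A : Type.

(** There are [n + 1] slots, numbered [0] to [n]. Tuples of a fixed length replace full assignments
    so that a finite structure yields finitely many of them. *)
Fixpoint tuple (n : nat) : Type :=
  match n with 0 => A | S n => (A * tuple n)%type end.

Fixpoint get {n : nat} : tuple n -> nat -> A :=
  match n with
  | 0 => fun u _ => u
  | S n => fun u k => match k with 0 => fst u | S k => get (snd u) k end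
  end.

Fixpoint set {n : nat} : tuple n -> nat -> A -> tuple n :=
  match n with
  | 0 => fun _ _ a => a
  | S n => fun u k a =>
      match k with 0 => (a, snd u) | S k => (fst u, set (snd u) k a) end
  end.

Lemma get_set_same n (u : tuple n) k a : get (set u k a) k = a.
Proof. revert k; induction n; intros [|k]; cbn; auto. Qed.

(** The bounds matter because every index past [n] denotes the last slot. *)
Lemma get_set_other n (u : tuple n) j k a :
  j <= n -> k <= n -> j <> k -> get (set u k a) j = get u j.
Proof.
  revert j k; induction n; intros [|j] [|k]; cbn; auto; try lia.
  intros. apply IHn; lia.
Qed.

Lemma tuple_finite n : Finite A -> Finite (tuple n).
Proof.
  intros HA. induction n as [|n [l Hl]]; [exact HA|].
  destruct HA as [k Hk]. exists (list_prod k l). intros [a u].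
  apply in_prod; auto.
Qed.

Lemma tuple_inhabited n : inhabited A -> inhabited (tuple n).
Proof. intros [a]. induction n as [|n [u]]; [now split|exact (inhabits (a, u))]. Qed.

End Tuples.

Arguments get {A n}.
Arguments set {A n}.

Fixpoint depth (phi : formula) : nat :=
  match phi with
  | Atom _ _ _ | Eq _ _ => 0
  | Not p => depth p
  | And p q => max (depth p) (depth q)
  | Ex _ p => S (depth p)
  end.

Section TupleModel.

Variables (A : structure) (J : var -> A) (N : nat).

(** The residue of a symbol modulo 4 tells the four families apart, and the quotient recovers the
    index. In all cases an element stands for its slot [0]. *)
Definition tuple_interp (m : symbol) (u v : tuple A N) : Prop :=
  match m mod 4 with
  | 0 => interp A (m / 4) (get u 0) (get v 0)
  | 1 => J (m / 4) = get v 0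
  | 2 => get u (m / 4) = get v 0
  | _ => forall k, 1 <= k < m / 4 -> get u k = get v k
  end.

Definition tuple_structure : structure :=
  {| carrier := tuple A N;
     carrier_inhabited := tuple_inhabited A N (carrier_inhabited A);
     interp := tuple_interp |}.

Lemma div_mod_4 r n : r < 4 -> (r + 4 * n) mod 4 = r /\ (r + 4 * n) / 4 = n.
Proof.
  intros H. rewrite (Nat.mul_comm 4), Nat.Div0.mod_add, Nat.div_add by lia.
  rewrite Nat.mod_small, Nat.div_small; lia.
Qed.

Lemma tuple_rel a u v :
  tuple_interp (rel_sym a) u v = interp A a (get u 0) (get v 0).
Proof.
  unfold tuple_interp, rel_sym.
  change (4 * a) with (0 + 4 * a).
  destruct (div_mod_4 0 a ltac:(lia)) as [-> ->]; reflexivity.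
Qed.

Lemma tuple_free y u : tuple_interp (free_sym y) u = fun v => J y = get v 0.
Proof.
  unfold tuple_interp, free_sym. change (S (4 * y)) with (1 + 4 * y).
  destruct (div_mod_4 1 y ltac:(lia)) as [-> ->]; reflexivity.
Qed.

Lemma tuple_level k u :
  tuple_interp (level_sym k) u = fun v => get u k = get v 0.
Proof.
  unfold tuple_interp, level_sym. change (S (S (4 * k))) with (2 + 4 * k).
  destruct (div_mod_4 2 k ltac:(lia)) as [-> ->]; reflexivity.
Qed.

Lemma tuple_agree d u v :
  tuple_interp (agree_sym d) u v = (forall k, 1 <= k < d -> get u k = get v k).
Proof.
  unfold tuple_interp, agree_sym. change (S (S (S (4 * d)))) with (3 + 4 * d).
  destruct (div_mod_4 3 d ltac:(lia)) as [-> ->]; reflexivity.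
Qed.

Lemma tuple_value u : tuple_interp value_sym u = fun v => get u 0 = get v 0.
Proof. exact (tuple_level 0 u). Qed.

Lemma tuple_value_surj (a : A) : exists s : tuple A N, get s 0 = a.
Proof.
  destruct (tuple_inhabited A N (carrier_inhabited A)) as [u].
  exists (set u 0 a). apply get_set_same.
Qed.

Lemma tuple_free_axiom (I : var -> tuple_structure) x :
  satisfies tuple_structure I (free_axiom x).
Proof.
  apply satisfies_free_axiom. cbn -[free_sym value_sym].
  destruct (tuple_value_surj (J x)) as [s Hs].
  exists s. intros u. now rewrite tuple_free, tuple_value, Hs.
Qed.

(** The slots in use are [d] up to [d + depth phi - 1], and the last of them must be at most [N]. *)
Lemma tuple_axioms (I : var -> tuple_structure) phi d :
  1 <= d -> d + depth phi <= S N ->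
  satisfies tuple_structure I (axioms phi d).
Proof.
  revert d; induction phi; cbn [depth axioms]; intros d Hd HN.
  - split; apply tuple_free_axiom.
  - split; apply tuple_free_axiom.
  - auto.
  - split; [apply IHphi1|apply IHphi2]; lia.
  - split; [|apply IHphi; lia]. split; [|split].
    + apply satisfies_level_total. cbn -[level_sym value_sym]. intros u.
      destruct (tuple_value_surj (get u d)) as [s Hs].
      exists s. now rewrite tuple_level, tuple_value, Hs.
    + apply satisfies_level_agree. cbn -[level_sym agree_sym]. intros u w.
      rewrite !tuple_agree, !tuple_level. intros H. split.
      * intros k Hk. apply H. lia.
      * now rewrite H by lia.
    + apply satisfies_level_update. cbn -[level_sym agree_sym value_sym].
      (* Overwriting slot [d] by the element that [s] denotes leaves the slots below [d]
         unchanged. *)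
      intros u s. exists (set u d (get s 0)).
      rewrite tuple_agree, tuple_level, tuple_value, get_set_same.
      split; [|reflexivity]. intros k Hk. now rewrite get_set_other by lia.
Qed.

Lemma tuple_satisfies phi :
  depth phi <= N -> satisfies A J phi ->
  exists I : var -> tuple_structure, satisfies tuple_structure I (reduction phi).
Proof.
  intros HN H. destruct (carrier_inhabited tuple_structure) as [u].
  assert (Hax : satisfies tuple_structure (fun _ => u) (axioms phi 1)).
  { apply tuple_axioms; lia. }
  (* Any tuple can start: at depth [1] no variable is stored in a slot yet, and free variables read
     [J] in every tuple. *)
  exists (fun _ => u). split; [exact Hax|]. exists u.
  refine (proj1 (translate_correct A tuple_structure (fun a v => a = get v 0)
    _ _ _ _ phi 1 (fun _ => u) _ free_sym J Hax _ _) H).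
  (* Equal rows are compared at a tuple whose slot [0] holds [a]. *)
  - intros a b E. destruct (tuple_value_surj a) as [s <-].
    apply (f_equal (fun P => P s)) in E. cbn in E. symmetry. now rewrite <- E.
  - intros s. exists (get s 0). cbn -[value_sym]. now rewrite tuple_value.
  - intros a. destruct (tuple_value_surj a) as [s <-]. exists s.
    cbn -[value_sym]. now rewrite tuple_value.
  - intros r a b. split.
    + intros Hr. destruct (tuple_value_surj a) as [s <-], (tuple_value_surj b) as [t <-].
      exists s, t. cbn -[rel_sym]. now rewrite tuple_rel.
    + intros (s & t & -> & -> & Hr). cbn -[rel_sym] in Hr.
      now rewrite tuple_rel in Hr.
  - intros. cbn -[free_sym]. now rewrite !tuple_free.
  - intros. cbn -[free_sym]. now rewrite tuple_free.
Qed.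

End TupleModel.

(** * Conservativity from the two model constructions *)

Lemma reduction_conservative : conservative reduction.
Proof.
  intros phi. split; split.
  - intros (A & J & H). exists (tuple_structure A J (depth phi)).
    now apply tuple_satisfies.
  - intros (M & I & H). exists (row_structure M).
    now apply (row_structure_satisfies M I).
  - intros (A & J & HF & H).
    destruct (tuple_satisfies A J (depth phi) phi (le_n _) H) as [I HI].
    exists (tuple_structure A J (depth phi)), I.
    split; [now apply tuple_finite|exact HI].
  - intros (M & I & HF & H).
    destruct (row_structure_satisfies M I phi H) as [J HJ].
    exists (row_structure M), J.
    split; [now apply row_structure_finite|exact HJ].
Qed.

(** * Computability in the weak call-by-value lambda-calculus *)

(** The Boolean form lets [reflexivity] check closedness of the concrete terms below. *)
Fixpoint closedb (k : nat) (s : term) : bool :=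
  match s with
  | TVar n => Nat.ltb n k
  | TApp s t => closedb k s && closedb k t
  | TLam s => closedb (S k) s
  end.

Lemma closedb_spec k s : closedb k s = true -> closed_below k s.
Proof.
  revert k; induction s; cbn; intros k H.
  - now apply Nat.ltb_lt.
  - apply andb_prop in H as [H1 H2]; auto.
  - auto.
Qed.

Lemma closed_below_le j k s : closed_below j s -> j <= k -> closed_below k s.
Proof.
  revert j k; induction s; cbn; intros j k H L.
  - lia.
  - destruct H; eauto.
  - apply (IHs (S j)); [exact H|lia].
Qed.

Lemma subst_closed_below s k j u : closed_below k s -> k <= j -> subst s j u = s.
Proof.
  revert k j; induction s as [n|s1 IH1 s2 IH2|s IH]; cbn; intros k j H L.
  - destruct (Nat.eqb_spec n j); [lia|reflexivity].
  - destruct H. now rewrite (IH1 k), (IH2 k).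
  - rewrite (IH (S k)); [reflexivity|exact H|lia].
Qed.

(** * Simultaneous substitution of closed terms *)

Fixpoint psubst (sigma : list term) (k : nat) (s : term) : term :=
  match s with
  | TVar n => if Nat.ltb n k then TVar n else nth (n - k) sigma (TVar n)
  | TApp s t => TApp (psubst sigma k s) (psubst sigma k t)
  | TLam s => TLam (psubst sigma (S k) s)
  end.

Lemma psubst_nil k s : psubst [] k s = s.
Proof.
  revert k; induction s as [n|s1 IH1 s2 IH2|s IH]; cbn -[Nat.ltb]; intros k.
  - destruct (n <? k), (n - k); reflexivity.
  - now rewrite IH1, IH2.
  - now rewrite IH.
Qed.

Lemma psubst_closed_below sigma k s : closed_below k s -> psubst sigma k s = s.
Proof.
  revert k; induction s as [n|s1 IH1 s2 IH2|s IH]; cbn -[Nat.ltb]; intros k H.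
  - now destruct (Nat.ltb_spec n k); [|lia].
  - destruct H. now rewrite IH1, IH2.
  - now rewrite IH.
Qed.

(** A beta step under an environment just adds the argument to the environment. An index beyond
    [sigma] is left unchanged on both sides, so [s] needs no bound. *)
Lemma subst_psubst sigma k s v :
  Forall closed sigma ->
  subst (psubst sigma (S k) s) k v = psubst (v :: sigma) k s.
Proof.
  intros Hs. revert k; induction s as [n|s1 IH1 s2 IH2|s IH];
    cbn [psubst subst]; intros k.
  - destruct (Nat.ltb_spec n (S k)), (Nat.ltb_spec n k); try lia; cbn [subst].
    + destruct (Nat.eqb_spec n k); [lia|reflexivity].
    + replace n with k by lia. now rewrite Nat.eqb_refl, Nat.sub_diag.
    + replace (n - k) with (S (n - S k)) by lia. cbn [nth].
      destruct (nth_in_or_default (n - S k) sigma (TVar n)) as [Hin|E].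
      * rewrite Forall_forall in Hs.
        apply (subst_closed_below _ 0); [now apply Hs|lia].
      * rewrite E. cbn. destruct (Nat.eqb_spec n k); [lia|reflexivity].
  - now rewrite IH1, IH2.
  - now rewrite IH.
Qed.

Lemma psubst_closed sigma k s :
  Forall closed sigma -> closed_below (k + length sigma) s ->
  closed_below k (psubst sigma k s).
Proof.
  intros Hs. revert k; induction s as [n|s1 IH1 s2 IH2|s IH];
    cbn [psubst closed_below]; intros k H.
  - destruct (Nat.ltb_spec n k); [assumption|].
    apply (closed_below_le 0); [|lia]. rewrite Forall_forall in Hs.
    apply Hs, nth_In. lia.
  - destruct H; auto.
  - apply IH. exact H.
Qed.

(** * Realizability of functions by lambda-terms *)

Definition value (v : term) : Prop := closed v /\ exists s, v = TLam s.

Lemma eval_value v : value v -> eval v v.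
Proof. intros [_ [s ->]]. constructor. Qed.

Record ty : Type := Ty {
  ty_car :> Type;
  realizes : ty_car -> term -> Prop;
  realizes_value : forall x v, realizes x v -> value v
}.

Arguments realizes : clear implicits.

Lemma enc_nat_value n : value (enc_nat n).
Proof.
  split; [|destruct n; cbn; eauto].
  assert (H : forall k, closed_below k (enc_nat n)); [|apply H].
  induction n; cbn; intros k; [lia|]. split; [lia|apply IHn].
Qed.

Lemma enc_formula_value phi : value (enc_formula phi).
Proof.
  split; [|destruct phi; cbn; unfold enc_constructor; eauto].
  assert (N : forall n k, closed_below k (enc_nat n)).
  { intros n k. apply (closed_below_le 0); [apply enc_nat_value|lia]. }
  assert (H : forall k, closed_below k (enc_formula phi)); [|apply H].
  induction phi; cbn; intros k; repeat split; auto; lia.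
Qed.

Definition tnat : ty.
Proof.
  refine (Ty nat (fun n v => v = enc_nat n) _).
  intros n v ->. apply enc_nat_value.
Defined.

Definition tform : ty.
Proof.
  refine (Ty formula (fun phi v => v = enc_formula phi) _).
  intros phi v ->. apply enc_formula_value.
Defined.

(* Functions that are only required to be correct on arguments satisfying [P]:
   this is what is known of a recursive call while the recursion is being
   verified. *)
Definition parr (S : ty) (P : S -> Prop) (T : ty) : ty.
Proof.
  refine (Ty (S -> T) (fun f t => value t /\
    forall x v, P x -> realizes S x v ->
      exists w, eval (TApp t v) w /\ realizes T (f x) w) _).
  now intros f v [H _].
Defined.

Definition arr (S T : ty) : ty := parr S (fun _ => True) T.

Definition ctx : Type := list {T : ty & T}.

Definition ext (T : ty) (x : T) (G : ctx) : ctx :=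
  existT (fun T : ty => T : Type) T x :: G.

Definition models (G : ctx) (sigma : list term) : Prop :=
  Forall2 (fun p v => realizes (projT1 p) (projT2 p) v) G sigma.

(** A semantic typing judgement that also names the computed element [x]: a derivation that follows
    the shape of a term proves its termination and correctness at once. *)
Definition has (G : ctx) (s : term) (T : ty) (x : T) : Prop :=
  forall sigma, models G sigma ->
    exists w, eval (psubst sigma 0 s) w /\ realizes T x w.

Lemma models_closed G sigma : models G sigma -> Forall closed sigma.
Proof.
  induction 1 as [|p v G sigma H _ IH]; constructor; [|exact IH].
  now apply realizes_value in H as [H _].
Qed.

Lemma models_length G sigma : models G sigma -> length sigma = length G.
Proof. intros H. symmetry. exact (Forall2_length H). Qed.

Lemma has_var G n T x :
  nth_error G n = Some (existT (fun T : ty => T : Type) T x) -> has G (TVar n) T x.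
Proof.
  intros H sigma Hs. cbn. rewrite Nat.sub_0_r.
  (* The default of [nth] mentions [n]; generalizing it lets the index shift in the induction. *)
  generalize (TVar n) as t. revert n H.
  induction Hs as [|p v G sigma Hp _ IH]; intros [|n] H t; try discriminate.
  - injection H as ->. exists v. split; [|exact Hp].
    exact (eval_value _ (realizes_value _ _ _ Hp)).
  - exact (IH n H t).
Qed.

Lemma has_realizer G T x v : realizes T x v -> has G v T x.
Proof.
  intros H sigma _. exists v. destruct (realizes_value _ _ _ H) as [Hc Hv].
  rewrite psubst_closed_below by exact Hc. split; [|exact H].
  apply eval_value. now split.
Qed.

Lemma has_nat G n : has G (enc_nat n) tnat n.
Proof. now apply has_realizer. Qed.

Lemma eval_app_value s t v w :
  eval t v -> eval (TApp s v) w -> value v -> eval (TApp s t) w.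
Proof.
  intros Ht Hw [_ [v' ->]]. inversion Hw as [|? ? ? ? ? Hs Hv Hb]; subst.
  inversion Hv; subst. econstructor; eassumption.
Qed.

Lemma eval_app_fun s f t w :
  eval s f -> value f -> eval (TApp f t) w -> eval (TApp s t) w.
Proof.
  intros Hs [_ [f' ->]] Hw. inversion Hw as [|? ? ? ? ? Hf Ht Hb]; subst.
  inversion Hf; subst. econstructor; eassumption.
Qed.

Lemma has_papp G s t (U : ty) P (T : ty) (f : U -> T) x :
  has G s (parr U P T) f -> P x -> has G t U x -> has G (TApp s t) T (f x).
Proof.
  intros Hs HP Ht sigma Hsig.
  destruct (Hs sigma Hsig) as (u & Hu & Hval & Hf).
  destruct (Ht sigma Hsig) as (v & Hv & Hx).
  destruct (Hf x v HP Hx) as (w & Hw & Hr).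
  exists w. split; [|exact Hr]. cbn.
  apply (eval_app_fun _ u); [assumption|assumption|].
  apply (eval_app_value _ _ v); [assumption|assumption|].
  now apply realizes_value in Hx.
Qed.

Lemma has_app G s t (U T : ty) (f : U -> T) x :
  has G s (arr U T) f -> has G t U x -> has G (TApp s t) T (f x).
Proof. intros Hs Ht. exact (has_papp _ _ _ U _ T f x Hs I Ht). Qed.

Lemma psubst_lam_value G sigma s :
  models G sigma -> closedb (S (length G)) s = true ->
  value (TLam (psubst sigma 1 s)).
Proof.
  intros Hsig Hc. split; [|eauto]. unfold closed. cbn.
  apply psubst_closed; [now apply models_closed in Hsig|].
  rewrite (models_length G sigma Hsig). now apply closedb_spec.
Qed.

Lemma eval_beta G sigma s v w :
  models G sigma -> value v ->
  eval (psubst (v :: sigma) 0 s) w -> eval (TApp (TLam (psubst sigma 1 s)) v) w.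
Proof.
  intros Hsig Hv Hw. econstructor; [constructor|now apply eval_value|].
  rewrite subst_psubst; [exact Hw|now apply models_closed in Hsig].
Qed.

Lemma has_plam G s (U : ty) P (T : ty) (f : U -> T) :
  closedb (S (length G)) s = true ->
  (forall x, P x -> has (ext U x G) s T (f x)) -> has G (TLam s) (parr U P T) f.
Proof.
  intros Hc Hb sigma Hsig. cbn. exists (TLam (psubst sigma 1 s)).
  split; [constructor|]. split; [now apply (psubst_lam_value G)|].
  intros x v HP Hx.
  destruct (Hb x HP (v :: sigma)) as (w & Hw & Hr); [now constructor|].
  exists w. split; [|exact Hr].
  apply (eval_beta G); [assumption|now apply realizes_value in Hx|assumption].
Qed.

Lemma has_lam G s (U T : ty) (f : U -> T) :
  closedb (S (length G)) s = true ->
  (forall x, has (ext U x G) s T (f x)) -> has G (TLam s) (arr U T) f.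
Proof. intros Hc Hb. apply has_plam; auto. Qed.

(** ** Recursion *)

(* With [D := fun d x => F (fun y => d d y) x], the term [fun y => D D y]
   unfolds to [F (fun y => D D y)] once it is applied, as call-by-value requires. *)
Definition fix_dup (b : term) : term :=
  TLam (TLam (TApp (TApp (TLam (TLam b))
    (TLam (TApp (TApp (TVar 2) (TVar 2)) (TVar 0)))) (TVar 0))).

Definition fix_term (b : term) : term :=
  TLam (TApp (TApp (fix_dup b) (fix_dup b)) (TVar 0)).

Lemma fix_term_value b : closedb 2 b = true -> value (fix_term b).
Proof.
  intros H%closedb_spec. split; [|unfold fix_term; eauto].
  unfold closed, fix_term, fix_dup. cbn.
  repeat split; try lia; apply (closed_below_le 2); (assumption || lia).
Qed.

(** Unfolding the self-application once puts [fix_term b] itself in place of the recursion variable;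
    its eta-expanded form stops further unfolding until the next call. *)
Lemma eval_fix_term b v w :
  closedb 2 b = true -> value v ->
  eval (psubst [v; fix_term b] 0 b) w -> eval (TApp (fix_term b) v) w.
Proof.
  intros Hb Hv Hw. pose proof (fix_term_value b Hb) as Hf.
  apply closedb_spec in Hb.
  assert (Sb : forall j u, 2 <= j -> subst b j u = b).
  { intros j u L. now apply (subst_closed_below b 2). }
  assert (Sv : forall k u, subst v k u = v).
  { intros k u. apply (subst_closed_below v 0); [apply Hv|lia]. }
  unfold fix_term at 1. econstructor; [constructor|now apply eval_value|].
  cbn. rewrite !Sb by lia.
  fold (fix_dup b). econstructor.
  - econstructor; [constructor|constructor|]. cbn. rewrite !Sb by lia.
    fold (fix_dup b). constructor.
  - now apply eval_value.
  - cbn. rewrite !Sb by lia. fold (fix_dup b). fold (fix_term b).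
    econstructor.
    + econstructor; [constructor|constructor|]. cbn. constructor.
    + now apply eval_value.
    (* Seen as an instance under the empty environment, [b] turns the two pending substitutions into
       the two entries of an environment. *)
    + rewrite <- (psubst_nil 2 b) at 1.
      fold (fix_dup b). fold (fix_term b).
      rewrite subst_psubst by constructor.
      rewrite subst_psubst by (constructor; [apply Hf|constructor]). exact Hw.
Qed.

(** Well-founded induction on [mu]: while the body runs on [x], [fix_term b] is known to be correct
    on smaller arguments, which is what [parr] records. In [b], index [0] is the argument and index
    [1] the recursive function. *)
Lemma has_fix b (U T : ty) (f : U -> T) (mu : U -> nat) :
  closedb 2 b = true ->
  (forall x, has (ext U x (ext (parr U (fun y => mu y < mu x) T) f [])) b T (f x)) ->
  realizes (arr U T) f (fix_term b).
Proof.
  intros Hc Hb. split; [now apply fix_term_value|].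
  intros x v _. remember (mu x) as n eqn:E. revert x v E.
  induction n as [n IH] using lt_wf_ind. intros x v -> Hx.
  destruct (Hb x [v; fix_term b]) as (w & Hw & Hr).
  { constructor; [exact Hx|]. constructor; [|constructor].
    split; [now apply fix_term_value|]. intros y u L Hy. now apply (IH (mu y)). }
  exists w. split; [|exact Hr].
  apply eval_fix_term; [assumption|now apply realizes_value in Hx|assumption].
Qed.

(** ** Constructors and case distinctions *)

(** The argument is passed through a beta-redex so that it is evaluated before it lands under the
    binders of the Scott encoding, where evaluation would not reach it. The constructor terms for
    formulas do the same. *)
Definition succ_term (s : term) : term :=
  TApp (TLam (TLam (TLam (TApp (TVar 0) (TVar 2))))) s.

Lemma has_succ G s n : has G s tnat n -> has G (succ_term s) tnat (S n).
Proof.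
  intros H sigma Hsig. destruct (H sigma Hsig) as (v & Hv & ->).
  exists (enc_nat (S n)). split; [|reflexivity].
  econstructor; [constructor|exact Hv|constructor].
Qed.

Lemma subst_enc_nat n k u : subst (enc_nat n) k u = enc_nat n.
Proof. apply (subst_closed_below _ 0); [apply enc_nat_value|lia]. Qed.

Lemma subst_enc_formula phi k u : subst (enc_formula phi) k u = enc_formula phi.
Proof. apply (subst_closed_below _ 0); [apply enc_formula_value|lia]. Qed.

(** The five binders of [enc_constructor] shift the arguments: the last one has index [5]. *)
Definition Atom_term (a x y : term) : term :=
  TApp (TApp (TApp (TLam (TLam (TLam
    (enc_constructor 0 [TVar 7; TVar 6; TVar 5])))) a) x) y.

Definition Not_term (p : term) : term :=
  TApp (TLam (enc_constructor 2 [TVar 5])) p.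

Definition And_term (p q : term) : term :=
  TApp (TApp (TLam (TLam (enc_constructor 3 [TVar 6; TVar 5]))) p) q.

Definition Ex_term (x p : term) : term :=
  TApp (TApp (TLam (TLam (enc_constructor 4 [TVar 6; TVar 5]))) x) p.

Lemma has_Atom G s t r a x y :
  has G s tnat a -> has G t tnat x -> has G r tnat y ->
  has G (Atom_term s t r) tform (Atom a x y).
Proof.
  intros Hs Ht Hr sigma Hsig.
  destruct (Hs sigma Hsig) as (v1 & H1 & ->), (Ht sigma Hsig) as (v2 & H2 & ->),
    (Hr sigma Hsig) as (v3 & H3 & ->).
  exists (enc_formula (Atom a x y)). split; [|reflexivity].
  econstructor; [|exact H3|].
  - econstructor; [|exact H2|].
    + econstructor; [constructor|exact H1|constructor].
    + constructor.
  - cbn. rewrite !subst_enc_nat. constructor.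
Qed.

Lemma has_Not G s p : has G s tform p -> has G (Not_term s) tform (Not p).
Proof.
  intros Hs sigma Hsig. destruct (Hs sigma Hsig) as (v & H & ->).
  exists (enc_formula (Not p)). split; [|reflexivity].
  econstructor; [constructor|exact H|constructor].
Qed.

Lemma has_And G s t p q :
  has G s tform p -> has G t tform q -> has G (And_term s t) tform (And p q).
Proof.
  intros Hs Ht sigma Hsig.
  destruct (Hs sigma Hsig) as (v1 & H1 & ->), (Ht sigma Hsig) as (v2 & H2 & ->).
  exists (enc_formula (And p q)). split; [|reflexivity].
  econstructor; [|exact H2|].
  - econstructor; [constructor|exact H1|constructor].
  - cbn. rewrite !subst_enc_formula. constructor.
Qed.

Lemma has_Ex G s t x p :
  has G s tnat x -> has G t tform p -> has G (Ex_term s t) tform (Ex x p).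
Proof.
  intros Hs Ht sigma Hsig.
  destruct (Hs sigma Hsig) as (v1 & H1 & ->), (Ht sigma Hsig) as (v2 & H2 & ->).
  exists (enc_formula (Ex x p)). split; [|reflexivity].
  econstructor; [|exact H2|].
  - econstructor; [constructor|exact H1|constructor].
  - cbn. rewrite !subst_enc_nat. constructor.
Qed.

Definition nat_case (s z b : term) : term := TApp (TApp s z) (TLam b).

(** Call-by-value evaluates [z] even if [n] is a successor, so [z] must always realize some [x];
    this [x] has to be the result [r] only when [n = 0]. The other branch is delayed by its
    abstraction. *)
Lemma has_nat_case G s z b n (T : ty) (x r : T) :
  has G s tnat n -> has G z T x -> closedb (S (length G)) b = true ->
  (n = 0 -> x = r) ->
  (forall m, n = S m -> has (ext tnat m G) b T r) ->
  has G (nat_case s z b) T r.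
Proof.
  intros Hs Hz Hb H0 HS sigma Hsig.
  destruct (Hs sigma Hsig) as (v & Hv & ->), (Hz sigma Hsig) as (u & Hu & Hx).
  pose proof (realizes_value _ _ _ Hx) as Vu.
  assert (Su : forall k t, subst u k t = u).
  { intros k t. apply (subst_closed_below u 0); [apply Vu|lia]. }
  destruct n as [|m].
  - exists u. rewrite <- H0 by reflexivity. split; [|exact Hx].
    econstructor; [|constructor|].
    + econstructor; [exact Hv|exact Hu|]. cbn. constructor.
    + rewrite Su. now apply eval_value.
  - destruct (HS m eq_refl (enc_nat m :: sigma)) as (w & Hw & Hr); [now constructor|].
    exists w. split; [|exact Hr].
    econstructor; [|constructor|].
    + econstructor; [exact Hv|exact Hu|]. cbn. constructor.
    + cbn. rewrite !subst_enc_nat.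
      apply (eval_beta G); [assumption|apply enc_nat_value|assumption].
Qed.

Lemma subst_fold_TApp args h k u :
  Forall closed args ->
  subst (fold_left TApp args h) k u = fold_left TApp args (subst h k u).
Proof.
  intros H. revert h. induction H as [|a args Ha _ IH]; intros h; [reflexivity|].
  cbn. rewrite IH. cbn. rewrite (subst_closed_below a 0); [reflexivity|exact Ha|lia].
Qed.

Lemma eval_case s i args b0 b1 b2 b3 b4 w :
  eval s (enc_constructor i args) -> Forall closed args ->
  closed (TLam b0) -> closed (TLam b1) -> closed (TLam b2) ->
  closed (TLam b3) -> closed (TLam b4) -> i < 5 ->
  eval (fold_left TApp args (TLam (nth i [b0; b1; b2; b3; b4] b0))) w ->
  eval (TApp (TApp (TApp (TApp (TApp s (TLam b0)) (TLam b1)) (TLam b2)) (TLam b3))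
         (TLam b4)) w.
Proof.
  intros Hs Ha H0 H1 H2 H3 H4 Hi Hw.
  assert (E : forall s s' t, eval s (TLam (TLam s')) ->
            eval (TApp s (TLam t)) (TLam (subst s' 1 (TLam t)))).
  { intros s1 s' t E. econstructor; [exact E|constructor|constructor]. }
  unfold enc_constructor in Hs.
  apply (E _ _ b0) in Hs. cbn [subst] in Hs.
  apply (E _ _ b1) in Hs. cbn [subst] in Hs.
  apply (E _ _ b2) in Hs. cbn [subst] in Hs.
  apply (E _ _ b3) in Hs.
  econstructor; [exact Hs|constructor|].
  (* Closed arguments survive all five substitutions; only the head variable is replaced, by the
     branch number [i]. *)
  rewrite !subst_fold_TApp by exact Ha.
  replace (subst _ 0 (TLam b4)) with (TLam (nth i [b0; b1; b2; b3; b4] b0));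
    [exact Hw|].
  assert (Sb : forall b k u, closed (TLam b) -> subst b (S k) u = b).
  { intros b k u Hb. apply (subst_closed_below b 1); [exact Hb|lia]. }
  destruct i as [|[|[|[|[|i]]]]]; [..|lia]; cbn; symmetry;
    rewrite ?(Sb b0), ?(Sb b1), ?(Sb b2), ?(Sb b3), ?(Sb b4) by assumption;
    reflexivity.
Qed.

Definition formula_case (s b0 b1 b2 b3 b4 : term) : term :=
  TApp (TApp (TApp (TApp (TApp s (TLam (TLam (TLam b0)))) (TLam (TLam b1)))
    (TLam b2)) (TLam (TLam b3))) (TLam (TLam b4)).

Ltac eval_branch Hw :=
  repeat (eapply eval_app;
    [|apply eval_value; apply enc_nat_value || apply enc_formula_value|]);
  first [apply eval_lam | cbn [subst]; apply eval_lam
        | cbn [subst]; rewrite !subst_psubst by auto; exact Hw].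

(** Each branch learns the shape of [phi], so that [r] can be unfolded there. The last argument of
    the constructor has index [0]. *)
Lemma has_formula_case G s b0 b1 b2 b3 b4 phi (T : ty) (r : T) :
  has G s tform phi ->
  closedb (3 + length G) b0 = true -> closedb (2 + length G) b1 = true ->
  closedb (1 + length G) b2 = true -> closedb (2 + length G) b3 = true ->
  closedb (2 + length G) b4 = true ->
  (forall a x y, phi = Atom a x y ->
     has (ext tnat y (ext tnat x (ext tnat a G))) b0 T r) ->
  (forall x y, phi = Eq x y -> has (ext tnat y (ext tnat x G)) b1 T r) ->
  (forall p, phi = Not p -> has (ext tform p G) b2 T r) ->
  (forall p q, phi = And p q -> has (ext tform q (ext tform p G)) b3 T r) ->
  (forall x p, phi = Ex x p -> has (ext tform p (ext tnat x G)) b4 T r) ->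
  has G (formula_case s b0 b1 b2 b3 b4) T r.
Proof.
  intros Hs C0 C1 C2 C3 C4 H0 H1 H2 H3 H4 sigma Hsig.
  destruct (Hs sigma Hsig) as (v & Hv & ->).
  pose proof (models_closed _ _ Hsig) as Hcl.
  assert (C : forall b k, closedb (k + length G) b = true ->
            closed_below k (psubst sigma k b)).
  { intros b k H. apply psubst_closed; [exact Hcl|].
    rewrite (models_length _ _ Hsig). now apply closedb_spec. }
  apply C in C0, C1, C2, C3, C4.
  assert (En : forall n, closed (enc_nat n)) by (intros; apply enc_nat_value).
  assert (Ef : forall p, closed (enc_formula p)) by (intros; apply enc_formula_value).
  enough (exists w i args, enc_formula phi = enc_constructor i args /\
    Forall closed args /\ i < 5 /\
    eval (fold_left TApp args (TLam (nth i [TLam (TLam (psubst sigma 3 b0));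
      TLam (psubst sigma 2 b1); psubst sigma 1 b2;
      TLam (psubst sigma 2 b3); TLam (psubst sigma 2 b4)]
      (TLam (TLam (psubst sigma 3 b0)))))) w /\
    realizes T r w) as (w & i & args & Heq & Ha & Hi & Hw & Hr).
  { exists w. split; [|exact Hr]. rewrite Heq in Hv. eapply eval_case; eassumption. }
  destruct phi as [a x y|x y|p|p q|x p]; cbn [enc_formula].
  - destruct (H0 a x y eq_refl (enc_nat y :: enc_nat x :: enc_nat a :: sigma))
      as (w & Hw & Hr); [now repeat constructor|].
    exists w, 0. eexists. split; [reflexivity|]. repeat split; [auto|lia| |exact Hr].
    cbn [fold_left nth].
    eval_branch Hw.
  - destruct (H1 x y eq_refl (enc_nat y :: enc_nat x :: sigma))
      as (w & Hw & Hr); [now repeat constructor|].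
    exists w, 1. eexists. split; [reflexivity|]. repeat split; [auto|lia| |exact Hr].
    cbn [fold_left nth].
    eval_branch Hw.
  - destruct (H2 p eq_refl (enc_formula p :: sigma))
      as (w & Hw & Hr); [now repeat constructor|].
    exists w, 2. eexists. split; [reflexivity|]. repeat split; [auto|lia| |exact Hr].
    cbn [fold_left nth].
    eval_branch Hw.
  - destruct (H3 p q eq_refl (enc_formula q :: enc_formula p :: sigma))
      as (w & Hw & Hr); [now repeat constructor|].
    exists w, 3. eexists. split; [reflexivity|]. repeat split; [auto|lia| |exact Hr].
    cbn [fold_left nth].
    eval_branch Hw.
  - destruct (H4 x p eq_refl (enc_formula p :: enc_nat x :: sigma))
      as (w & Hw & Hr); [now repeat constructor|].
    exists w, 4. eexists. split; [reflexivity|]. repeat split; [auto|lia| |exact Hr].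
    cbn [fold_left nth].
    eval_branch Hw.
Qed.

(** ** The reduction as a lambda-term *)

Definition quadruple_body : term :=
  nat_case (TVar 0) (enc_nat 0)
    (succ_term (succ_term (succ_term (succ_term (TApp (TVar 2) (TVar 0)))))).

Definition quadruple_term : term := fix_term quadruple_body.

Lemma quadruple_realizes : realizes (arr tnat tnat) (fun n => 4 * n) quadruple_term.
Proof.
  apply (has_fix _ tnat tnat (fun n => 4 * n) (fun n => n)); [reflexivity|].
  intros n. eapply has_nat_case.
  - now apply has_var.
  - apply has_nat.
  - reflexivity.
  - now intros ->.
  - intros m ->. replace (4 * S m) with (S (S (S (S (4 * m))))) by lia.
    do 4 apply has_succ.
    eapply (has_papp _ _ _ tnat _ tnat (fun n => 4 * n) m).
    + now apply has_var.
    + cbn. lia.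
    + now apply has_var.
Qed.

Definition rel_sym_term (s : term) : term := TApp quadruple_term s.
Definition free_sym_term (s : term) : term := succ_term (rel_sym_term s).
Definition level_sym_term (s : term) : term := succ_term (free_sym_term s).
Definition agree_sym_term (s : term) : term := succ_term (level_sym_term s).

Lemma has_rel_sym G s n : has G s tnat n -> has G (rel_sym_term s) tnat (rel_sym n).
Proof.
  apply (has_app _ _ _ tnat tnat (fun n => 4 * n)).
  apply has_realizer, quadruple_realizes.
Qed.

Lemma has_free_sym G s n : has G s tnat n -> has G (free_sym_term s) tnat (free_sym n).
Proof. intros H. now apply has_succ, has_rel_sym. Qed.

Lemma has_level_sym G s n : has G s tnat n -> has G (level_sym_term s) tnat (level_sym n).
Proof. intros H. now apply has_succ, has_free_sym. Qed.

Lemma has_agree_sym G s n : has G s tnat n -> has G (agree_sym_term s) tnat (agree_sym n).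
Proof. intros H. now apply has_succ, has_level_sym. Qed.

(** An equality test combined with the choice between two numbers, so that Booleans need no
    encoding; it computes [update] on environments. *)
Definition select (n m a b : nat) : nat := if Nat.eqb n m then a else b.

Definition select_body : term :=
  TLam (TLam (TLam
    (nat_case (TVar 3) (nat_case (TVar 2) (TVar 1) (TVar 1))
      (nat_case (TVar 3) (TVar 1)
        (TApp (TApp (TApp (TApp (TVar 6) (TVar 1)) (TVar 0)) (TVar 3)) (TVar 2)))))).

Definition select_term : term := fix_term select_body.

Lemma select_realizes :
  realizes (arr tnat (arr tnat (arr tnat (arr tnat tnat)))) select select_term.
Proof.
  apply (has_fix _ tnat (arr tnat (arr tnat (arr tnat tnat))) select (fun n => n));
    [reflexivity|].
  intros n. apply has_lam; [reflexivity|]. intros m.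
  apply has_lam; [reflexivity|]. intros a.
  apply has_lam; [reflexivity|]. intros b.
  (* The zero branch is evaluated for every [n], so the element it realizes is given as the result
     at [n = 0]. *)
  eapply has_nat_case with (x := if Nat.eqb 0 m then a else b : tnat).
  - now apply has_var.
  - apply has_nat_case with (n := m) (x := a : tnat).
    + now apply has_var.
    + now apply has_var.
    + reflexivity.
    + now intros ->.
    + intros m' ->. now apply has_var.
  - reflexivity.
  - now intros ->.
  - intros n' ->. apply has_nat_case with (n := m) (x := b : tnat).
    + now apply has_var.
    + now apply has_var.
    + reflexivity.
    + now intros ->.
    + intros m' ->. change (select (S n') (S m') a b) with (select n' m' a b).
      refine (has_app _ _ _ tnat tnat (select n' m' a) b _ _); [|now apply has_var].
      refine (has_app _ _ _ tnat (arr tnat tnat) (select n' m') a _ _);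
        [|now apply has_var].
      refine (has_app _ _ _ tnat (arr tnat (arr tnat tnat)) (select n') m' _ _);
        [|now apply has_var].
      eapply (has_papp _ _ _ tnat _ (arr tnat (arr tnat (arr tnat tnat))) select n').
      * now apply has_var.
      * cbn. lia.
      * now apply has_var.
Qed.

(** The arguments are placed under the binder unchanged, so their indices have to be supplied
    already shifted by one. *)
Definition update_term (env x k : term) : term :=
  TLam (TApp (TApp (TApp (TApp select_term (TVar 0)) x) k) (TApp env (TVar 0))).

Definition All_term (x p : term) : term := Not_term (Ex_term x (Not_term p)).
Definition Imp_term (p q : term) : term := Not_term (And_term p (Not_term q)).
Definition Iff_term (p q : term) : term := And_term (Imp_term p q) (Imp_term q p).

Lemma has_All G s t x p :
  has G s tnat x -> has G t tform p -> has G (All_term s t) tform (All x p).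
Proof. intros. now apply has_Not, has_Ex, has_Not. Qed.

Lemma has_Imp G s t p q :
  has G s tform p -> has G t tform q -> has G (Imp_term s t) tform (Imp p q).
Proof. intros. now apply has_Not, has_And, has_Not. Qed.

Lemma has_Iff G s t p q :
  has G s tform p -> has G t tform q -> has G (Iff_term s t) tform (Iff p q).
Proof. intros. now apply has_And; apply has_Imp. Qed.

Definition free_axiom_term (y : term) : term :=
  Ex_term (enc_nat 1) (All_term (enc_nat 0) (All_term (enc_nat 2)
    (Iff_term (Atom_term (free_sym_term y) (enc_nat 0) (enc_nat 2))
       (Atom_term (enc_nat value_sym) (enc_nat 1) (enc_nat 2))))).

Definition level_total_term (d : term) : term :=
  All_term (enc_nat 0) (Ex_term (enc_nat 1) (All_term (enc_nat 2)
    (Iff_term (Atom_term (level_sym_term d) (enc_nat 0) (enc_nat 2))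
       (Atom_term (enc_nat value_sym) (enc_nat 1) (enc_nat 2))))).

Definition level_agree_term (d : term) : term :=
  All_term (enc_nat 0) (All_term (enc_nat 1)
    (Imp_term (Atom_term (agree_sym_term (succ_term d)) (enc_nat 0) (enc_nat 1))
      (And_term (Atom_term (agree_sym_term d) (enc_nat 0) (enc_nat 1))
         (All_term (enc_nat 2)
           (Iff_term (Atom_term (level_sym_term d) (enc_nat 0) (enc_nat 2))
              (Atom_term (level_sym_term d) (enc_nat 1) (enc_nat 2))))))).

Definition level_update_term (d : term) : term :=
  All_term (enc_nat 0) (All_term (enc_nat 1) (Ex_term (enc_nat 2)
    (And_term (Atom_term (agree_sym_term d) (enc_nat 0) (enc_nat 2))
      (All_term (enc_nat 0)
        (Iff_term (Atom_term (level_sym_term d) (enc_nat 2) (enc_nat 0))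
           (Atom_term (enc_nat value_sym) (enc_nat 1) (enc_nat 0))))))).

Ltac has_auto :=
  repeat first
    [ assumption | apply has_nat | now apply has_var
    | apply has_All | apply has_Iff | apply has_Imp
    | apply has_Ex | apply has_And | apply has_Not | apply has_Atom
    | apply has_agree_sym | apply has_level_sym | apply has_free_sym
    | apply has_rel_sym | apply has_succ ].

Lemma has_free_axiom G s y :
  has G s tnat y -> has G (free_axiom_term s) tform (free_axiom y).
Proof. intros H. unfold free_axiom_term, free_axiom. has_auto. Qed.

Lemma has_level_total G s d :
  has G s tnat d -> has G (level_total_term s) tform (level_total d).
Proof. intros H. unfold level_total_term, level_total. has_auto. Qed.

Lemma has_level_agree G s d :
  has G s tnat d -> has G (level_agree_term s) tform (level_agree d).
Proof. intros H. unfold level_agree_term, level_agree. has_auto. Qed.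

Lemma has_level_update G s d :
  has G s tnat d -> has G (level_update_term s) tform (level_update d).
Proof. intros H. unfold level_update_term, level_update. has_auto. Qed.

Definition axioms_body : term :=
  TLam (formula_case (TVar 1)
    (And_term (free_axiom_term (TVar 1)) (free_axiom_term (TVar 0)))
    (And_term (free_axiom_term (TVar 1)) (free_axiom_term (TVar 0)))
    (TApp (TApp (TVar 3) (TVar 0)) (TVar 1))
    (And_term (TApp (TApp (TVar 4) (TVar 1)) (TVar 2))
       (TApp (TApp (TVar 4) (TVar 0)) (TVar 2)))
    (And_term
       (And_term (level_total_term (TVar 2))
          (And_term (level_agree_term (TVar 2)) (level_update_term (TVar 2))))
       (TApp (TApp (TVar 4) (TVar 0)) (succ_term (TVar 2))))).

Definition axioms_term : term := fix_term axioms_body.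

(** The precondition [P] is left general: recursive calls use decreasing size, the final term uses a
    condition that always holds. *)
Lemma has_axioms_call G s t u P phi d :
  has G s (parr tform P (arr tnat tform)) axioms -> P phi ->
  has G t tform phi -> has G u tnat d ->
  has G (TApp (TApp s t) u) tform (axioms phi d).
Proof.
  intros Hs HP Ht Hu.
  refine (has_app _ _ _ tnat tform (axioms phi) d _ Hu).
  exact (has_papp _ _ _ tform P (arr tnat tform) axioms phi Hs HP Ht).
Qed.

Lemma axioms_realizes :
  realizes (arr tform (arr tnat tform)) axioms axioms_term.
Proof.
  apply (has_fix _ tform (arr tnat tform) axioms fsize); [reflexivity|].
  intros phi. apply has_lam; [reflexivity|]. intros d.
  apply (has_formula_case _ _ _ _ _ _ _ phi); [now apply has_var|reflexivity..| | | | |].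
  - intros a x y ->. apply has_And; apply has_free_axiom; has_auto.
  - intros x y ->. apply has_And; apply has_free_axiom; has_auto.
  - intros p ->. cbn [axioms].
    eapply has_axioms_call; [now apply has_var|cbn; lia|has_auto..].
  - intros p q ->. apply has_And;
      (eapply has_axioms_call; [now apply has_var|cbn; lia|has_auto..]).
  - intros x p ->. apply has_And; [apply has_And; [|apply has_And]|].
    + apply has_level_total; has_auto.
    + apply has_level_agree; has_auto.
    + apply has_level_update; has_auto.
    + eapply has_axioms_call; [now apply has_var|cbn; lia|has_auto..].
Qed.

Definition translate_body : term :=
  TLam (TLam (formula_case (TVar 2)
    (Ex_term (enc_nat 1) (And_term
       (Atom_term (TApp (TVar 4) (TVar 1)) (enc_nat 0) (enc_nat 1))
       (Ex_term (enc_nat 2) (And_term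
          (Atom_term (TApp (TVar 4) (TVar 0)) (enc_nat 0) (enc_nat 2))
          (Atom_term (rel_sym_term (TVar 2)) (enc_nat 1) (enc_nat 2))))))
    (All_term (enc_nat 2) (Iff_term
       (Atom_term (TApp (TVar 3) (TVar 1)) (enc_nat 0) (enc_nat 2))
       (Atom_term (TApp (TVar 3) (TVar 0)) (enc_nat 0) (enc_nat 2))))
    (Not_term (TApp (TApp (TApp (TVar 4) (TVar 0)) (TVar 2)) (TVar 1)))
    (And_term (TApp (TApp (TApp (TVar 5) (TVar 1)) (TVar 3)) (TVar 2))
       (TApp (TApp (TApp (TVar 5) (TVar 0)) (TVar 3)) (TVar 2)))
    (Ex_term (enc_nat 1) (And_term
       (Atom_term (agree_sym_term (TVar 2)) (enc_nat 0) (enc_nat 1))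
       (Ex_term (enc_nat 0) (And_term
          (Atom_term (agree_sym_term (TVar 2)) (enc_nat 1) (enc_nat 0))
          (TApp (TApp (TApp (TVar 5) (TVar 0))
             (update_term (TVar 4) (TVar 2) (level_sym_term (TVar 3))))
             (succ_term (TVar 2))))))))).

Definition translate_term : term := fix_term translate_body.

Lemma has_translate_call G s t e u P phi env d :
  has G s (parr tform P (arr (arr tnat tnat) (arr tnat tform))) translate -> P phi ->
  has G t tform phi -> has G e (arr tnat tnat) env -> has G u tnat d ->
  has G (TApp (TApp (TApp s t) e) u) tform (translate phi env d).
Proof.
  intros Hs HP Ht He Hu.
  refine (has_app _ _ _ tnat tform (translate phi env) d _ Hu).
  refine (has_app _ _ _ (arr tnat tnat) (arr tnat tform) (translate phi) env _ He).
  exact (has_papp _ _ _ tform P (arr (arr tnat tnat) (arr tnat tform)) translate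
    phi Hs HP Ht).
Qed.

Lemma has_lookup G s t env x :
  has G s (arr tnat tnat) env -> has G t tnat x -> has G (TApp s t) tnat (env x).
Proof. apply (has_app _ _ _ tnat tnat env). Qed.

Lemma has_select G s t u v n m a b :
  has G s tnat n -> has G t tnat m -> has G u tnat a -> has G v tnat b ->
  has G (TApp (TApp (TApp (TApp select_term s) t) u) v) tnat (select n m a b).
Proof.
  intros Hs Ht Hu Hv.
  refine (has_app _ _ _ tnat tnat (select n m a) b _ Hv).
  refine (has_app _ _ _ tnat (arr tnat tnat) (select n m) a _ Hu).
  refine (has_app _ _ _ tnat (arr tnat (arr tnat tnat)) (select n) m _ Ht).
  refine (has_app _ _ _ tnat (arr tnat (arr tnat (arr tnat tnat))) select n _ Hs).
  apply has_realizer, select_realizes.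
Qed.

(** The recursion is on the formula alone; the environment is passed as a higher-order argument and
    realized by lambda-abstractions, without a data encoding. *)
Lemma translate_realizes :
  realizes (arr tform (arr (arr tnat tnat) (arr tnat tform))) translate translate_term.
Proof.
  apply (has_fix _ tform (arr (arr tnat tnat) (arr tnat tform)) translate fsize);
    [reflexivity|].
  intros phi. apply has_lam; [reflexivity|]. intros env.
  apply has_lam; [reflexivity|]. intros d.
  apply (has_formula_case _ _ _ _ _ _ _ phi); [now apply has_var|reflexivity..| | | | |].
  - intros a x y ->. cbn [translate]. has_auto; apply has_lookup; now apply has_var.
  - intros x y ->. cbn [translate]. has_auto; apply has_lookup; now apply has_var.
  - intros p ->. apply has_Not.
    eapply has_translate_call; [now apply has_var|cbn; lia|now apply has_var..].
  - intros p q ->. apply has_And;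
    (eapply has_translate_call; [now apply has_var|cbn; lia|now apply has_var..]).
  - intros x p ->. cbn [translate]. has_auto.
    eapply has_translate_call; [now apply has_var|cbn; lia|now apply has_var| |has_auto].
    (* By computation, [update env x k y] is [select y x k (env y)]. *)
    apply has_lam; [reflexivity|]. intros y. apply has_select; has_auto.
    apply has_lookup; now apply has_var.
Qed.

Definition reduction_term : term :=
  TLam (And_term (TApp (TApp axioms_term (TVar 0)) (enc_nat 1))
    (Ex_term (enc_nat 0)
      (TApp (TApp (TApp translate_term (TVar 0))
         (TLam (free_sym_term (TVar 0)))) (enc_nat 1)))).

Lemma reduction_realizes : has [] reduction_term (arr tform tform) reduction.
Proof.
  apply has_lam; [reflexivity|]. intros phi. apply has_And; [|apply has_Ex; [has_auto|]].
  - apply (has_axioms_call _ _ _ _ (fun _ => True));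
      [apply has_realizer, axioms_realizes|exact I|has_auto..].
  - apply (has_translate_call _ _ _ _ _ (fun _ => True));
      [apply has_realizer, translate_realizes|exact I|has_auto| |has_auto].
    apply has_lam; [reflexivity|]. intros y. has_auto.
Qed.

Lemma reduction_computable : computable reduction.
Proof.
  exists reduction_term. split.
  - apply closedb_spec. reflexivity.
  - intros phi.
    destruct (reduction_realizes [] (Forall2_nil _)) as (v & Hv & _ & Hf).
    rewrite psubst_nil in Hv.
    (* An abstraction evaluates only to itself. *)
    assert (v = reduction_term) as -> by now inversion Hv.
    now destruct (Hf phi (enc_formula phi) I eq_refl) as (w & Hw & ->).
Qed.

Theorem theorem3 :
  exists f : formula -> formula,
    computable f /\
    (forall phi : formula, FO3 (f phi)) /\
    linear_size f /\
    conservative f.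
Proof.
  exists reduction. split; [apply reduction_computable|].
  split; [apply reduction_FO3|].
  split; [apply reduction_linear_size|apply reduction_conservative].
Qed.
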